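(* Let $A$ be a general metric space. The map $\mathcal{F}\mapsto M^-(\mathcal{F})$ determines reflectors $WFil(A)\to Flat_{\mathcal{P}_1}(A)_0$ and $FFil(A)\to Flat_{\mathcal{P}_2}(A)_0$. Their respective right adjoints $Flat_{\mathcal{P}_1}(A)_0\hookrightarrow WFil(A)$ and $Flat_{\mathcal{P}_2}(A)_0\hookrightarrow FFil(A)$ send a module $M$ to the filter $\mathcal{F}(M)$ with basis $\Gamma(M)$, and they are full. (In particular these maps are well defined between the indicated categories.)
   Context: $[0,\infty]$ carries $[u,v]$ = truncated subtraction $\max(v-u,0)$, with $[\infty,v]=0$ for all $v$ and $[u,\infty]=\infty$ for $u<\infty$. It is the closed monoidal category with arrows $u\to v$ iff $u\ge v$, tensor $+$, unit $0$. A general metric space (category enriched over $[0,\infty]$) is a set $A$ with $A(-,-): A\times A\to[0,\infty]$ such that $A(x,x)=0$ and $A(y,z)+A(x,y)\ge A(x,z)$. A left module on $A$ (presheaf $A^{op}\to[0,\infty]$) is $M:A\to[0,\infty]$ with $M(y)+A(x,y)\ge M(x)$. A right module (functor $A\to[0,\infty]$) is $N:A\to[0,\infty]$ with $A(x,y)+N(x)\ge N(y)$. For a class $\mathcal{P}$ of functors $F:K\to[0,\infty]$ on general metric spaces $K$, a left module $M$ is $\mathcal{P}$-flat if $-*M: N\mapsto \inf_{x}(M(x)+N(x))$ on right modules preserves all limits with index in $\mathcal{P}$; explicitly: for every $F:K\to[0,\infty]$ in $\mathcal{P}$ and every family $(L_k)_{k\in K}$ of right modules on $A$ with $K(k,l)+L_k(x)\ge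 L_l(x)$ for all $k,l,x$, $$\inf_{x\in A}\Big(M(x)+\sup_{k\in K}[F(k),L_k(x)]\Big)=\sup_{k\in K}\Big[F(k),\inf_{x\in A}(M(x)+L_k(x))\Big].$$ $\mathcal{P}_1$ is the class of such $F$ with $K$ empty or $K$ the one-point space; $\mathcal{P}_2$ the class of such $F$ with $K$ having finitely many points. $Flat_{\mathcal{P}_i}(A)_0$ is the poset of $\mathcal{P}_i$-flat left modules, with an arrow $M\to N$ iff $M(x)\ge N(x)$ for all $x$. Filters on $A$ are proper (all members non-empty). For a filter $\mathcal{F}$ on $A$, $M^-(\mathcal{F})$ is the left module $x\mapsto\sup_{f\in\mathcal{F}}\inf_{y\in f}A(x,y)$. $\mathcal{F}$ is weakly flat if $\inf_{f\in\mathcal{F}}\sup_{x\in f}M^-(\mathcal{F})(x)=0$, equivalently for every $\epsilon>0$ there is $f\in\mathcal{F}$ such that for all $x\in f$ and $g\in\mathcal{F}$ there is $y\in g$ with $A(x,y)\le\epsilon$. $\mathcal{F}$ is flat if for every $\epsilon>0$ there is $f\in\mathcal{F}$ such that for every finite family $(x_i)_{i \in I}$ in $f$ and every $g\in\mathcal{F}$ there is $y\in g$ with $A(x_i,y)\le\epsilon$ for all $i$. $WFil(A)$ and $FFil(A)$ are the posets of weakly flat, respectively flat, filters on $A$ with reverse inclusion: an arrow $\mathcal{F}_1\to\mathcal{F}_2$ iff $\mathcal{F}_1\supseteq\mathcal{F}_2$. For a left module $M$, $\Gamma(M)=\{\Gamma(M)(\epsilon)\mid\epsilon\in\,]0,+\infty]\}$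 with $\Gamma(M)(\epsilon)=\{x\in A\mid M(x)\le\epsilon\}$, and $\mathcal{F}(M)$ is the collection of subsets of $A$ containing some member of $\Gamma(M)$. *)

(* Defs.v *)
From HB Require Import structures.
From mathcomp Require Export all_boot all_order all_algebra.
From mathcomp Require Export all_classical all_reals ereal.

Set Implicit Arguments.
Unset Strict Implicit.
Unset Printing Implicit Defensive.
Import Order.TTheory GRing.Theory Num.Theory.
Local Open Scope classical_set_scope.
Local Open Scope ereal_scope.

(* The monoidal closed category [0, oo] is represented by the elements u of
   \bar R with 0 <= u. *)

(* Suprema are taken in [0, oo], so that the empty supremum is 0, whereas
   ereal_sup set0 = -oo. For infima, ereal_inf set0 = +oo is already right. *)
Definition sup0 (R : realType) (S : set (\bar R)) : \bar R :=
  maxe 0 (ereal_sup S).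

(* As +oo - +oo = -oo in \bar R, this gives [oo, v] = 0 for all v,
   and [u, oo] = oo for u < oo. *)
Definition ihom (R : realType) (u v : \bar R) : \bar R := maxe (v - u) 0.

Record gmetric (R : realType) := GMetric {
  point :> Type;
  dist : point -> point -> \bar R;
  dist_ge0 : forall x y, 0 <= dist x y;
  distxx : forall x, dist x x = 0;
  dist_triangle : forall x y z, dist x z <= dist y z + dist x y }.

Record lmodule (R : realType) (A : gmetric R) := LModule {
  lmodule_fun :> A -> \bar R;
  lmodule_ge0 : forall x, 0 <= lmodule_fun x;
  lmodule_act : forall x y, lmodule_fun x <= lmodule_fun y + dist x y }.

Record rmodule (R : realType) (A : gmetric R) := RModule {
  rmodule_fun :> A -> \bar R;
  rmodule_ge0 : forall x, 0 <= rmodule_fun x;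
  rmodule_act : forall x y, rmodule_fun y <= dist x y + rmodule_fun x }.

(* A right module on K is the same thing as a functor K -> [0, oo]. *)
Definition index_class (R : realType) :=
  forall K : gmetric R, rmodule K -> Prop.

Definition P1 (R : realType) : index_class R := fun K _ =>
  (K -> False) \/ exists k : K, forall l : K, l = k.

Definition P2 (R : realType) : index_class R := fun K _ =>
  finite_set [set: K].

Definition is_flat (R : realType) (P : index_class R) (A : gmetric R)
    (M : lmodule A) : Prop :=
  forall (K : gmetric R) (F : rmodule K), P K F ->
  forall L : K -> rmodule A,
    (forall k l x, L l x <= dist k l + L k x) ->
    ereal_inf (range (fun x : A =>
      M x + sup0 (range (fun k : K => ihom (F k) (L k x)))))
    = sup0 (range (fun k : K =>
        ihom (F k) (ereal_inf (range (fun x : A => M x + L k x))))).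

Record Flat (R : realType) (P : index_class R) (A : gmetric R) := MkFlat {
  flat_module :> lmodule A;
  flat_moduleP : is_flat P flat_module }.

Definition Mminus (R : realType) (A : gmetric R) (F : set_system A) (x : A) :
    \bar R :=
  sup0 [set ereal_inf [set dist x y | y in f] | f in F].

Definition weakly_flat (R : realType) (A : gmetric R) (F : set_system A) :
    Prop :=
  ereal_inf [set sup0 [set Mminus F x | x in f] | f in F] = 0.

Definition flat_filter (R : realType) (A : gmetric R) (F : set_system A) :
    Prop :=
  forall e : R, (0 < e)%R ->
  exists2 f, F f &
    forall (I : finType) (x : I -> A), (forall i, f (x i)) ->
    forall g, F g -> exists2 y, g y & forall i, dist (x i) y <= e%:E.

Record Filters (R : realType) (A : gmetric R) (Q : set_system A -> Prop) :=
  MkFilters {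
    filter_sets :> set_system A;
    filter_sets_proper : ProperFilter filter_sets;
    filter_setsP : Q filter_sets }.

Notation WFil A := (Filters (@weakly_flat _ A)).
Notation FFil A := (Filters (@flat_filter _ A)).

Definition Gamma (R : realType) (A : gmetric R) (M : lmodule A) (e : \bar R) :
    set A :=
  [set x | M x <= e].

Definition filter_of_module (R : realType) (A : gmetric R) (M : lmodule A) :
    set_system A :=
  filter_from [set e : \bar R | 0 < e] (Gamma M).

(* In both posets below, X <= Y means that there is an arrow X -> Y: the order
   is the reverse of the pointwise order, resp. of inclusion. *)
Fact arrow_display : Order.disp_t. Proof. exact: Order.Disp tt tt. Qed.

Section FlatPoset.
Variables (R : realType) (P : index_class R) (A : gmetric R).

Definition flat_arrow (M N : Flat P A) : bool := `[< forall x, N x <= M x >].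

Lemma flat_arrow_refl : reflexive flat_arrow.
Proof. by move=> M; apply/asboolP => x. Qed.

Lemma flat_arrow_anti : antisymmetric flat_arrow.
Proof.
move=> [[M M0 MA] MP] [[N N0 NA] NP] /andP[/asboolP/= NM /asboolP/= MN].
have E : M = N by apply/funext => x; apply/le_anti; rewrite MN NM.
move: NM MN => _ _; subst N.
have E0 := Prop_irrelevance M0 N0; subst N0.
have EA := Prop_irrelevance MA NA; subst NA.
by rewrite (Prop_irrelevance MP NP).
Qed.

Lemma flat_arrow_trans : transitive flat_arrow.
Proof.
move=> N M L /asboolP NM /asboolP LN; apply/asboolP => x.
exact: le_trans (LN x) (NM x).
Qed.

HB.instance Definition _ := gen_eqMixin (Flat P A).
HB.instance Definition _ := gen_choiceMixin (Flat P A).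
HB.instance Definition _ := Order.Le_isPOrder.Build arrow_display (Flat P A)
  flat_arrow_refl flat_arrow_anti flat_arrow_trans.
End FlatPoset.

Section FiltersPoset.
Variables (R : realType) (A : gmetric R) (Q : set_system A -> Prop).

Definition filters_arrow (F G : Filters Q) : bool :=
  `[< (G : set_system A) `<=` F >].

Lemma filters_arrow_refl : reflexive filters_arrow.
Proof. by move=> F; apply/asboolP. Qed.

Lemma filters_arrow_anti : antisymmetric filters_arrow.
Proof.
move=> [F F0 FQ] [G G0 GQ] /andP[/asboolP/= GF /asboolP/= FG].
have E : F = G by apply/seteqP.
move: GF FG => _ _; subst G.
by rewrite (Prop_irrelevance F0 G0) (Prop_irrelevance FQ GQ).
Qed.

Lemma filters_arrow_trans : transitive filters_arrow.
Proof.
move=> G F H /asboolP GF /asboolP HG; apply/asboolP.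
exact: subset_trans HG GF.
Qed.

HB.instance Definition _ := gen_eqMixin (Filters Q).
HB.instance Definition _ := gen_choiceMixin (Filters Q).
HB.instance Definition _ := Order.Le_isPOrder.Build arrow_display (Filters Q)
  filters_arrow_refl filters_arrow_anti filters_arrow_trans.
End FiltersPoset.

(* Functors, adjunctions and fullness between posets viewed as categories. *)
Section PosetCategories.
Local Open Scope order_scope.
Variables (d d' : Order.disp_t) (C : porderType d) (D : porderType d').

Definition functor (L : C -> D) : Prop := {homo L : x y / x <= y}.

Definition full (L : C -> D) : Prop := forall x y, L x <= L y -> x <= y.

Definition left_adjoint (L : C -> D) (G : D -> C) : Prop :=
  forall x y, (L x <= y) = (x <= G y).

End PosetCategories.

(* L is a reflector whose right adjoint is the full embedding G. *)
Definition reflector (d d' : Order.disp_t) (C : porderType d)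
    (D : porderType d') (L : C -> D) (G : D -> C) : Prop :=
  [/\ functor L, functor G, left_adjoint L G, full G & injective G].

(* Main.v *)
(* If F is weakly flat then inf_x (M^-(F)(x) + N(x)) is the lower limit of N
   along F; hence M^-(F) commutes with the weights [u, -], and with finite
   suprema as soon as finitely many points of a small member of F can be
   approximated by a single one, that is, when F is flat. Conversely, applying
   flatness of M to the representables A(x_i, -) with weights M(x_i) gives, for
   each e, a point y with M(y) <= e and A(x_i, y) <= M(x_i) + e for all i: no
   x_i shows that F(M) is proper, one that M^-(F(M)) = M, and finitely many that
   F(M) is flat. The adjunction M <= M^-(F) iff F(M) `<=` F is then formal. *)
Require Import Defs.
Set Implicit Arguments.
Unset Strict Implicit.
Unset Printing Implicit Defensive.
Import Order.TTheory GRing.Theory Num.Theory.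
Local Open Scope classical_set_scope.
Local Open Scope ereal_scope.

(** * Suprema and internal homs in [0, oo] *)

Section Sup0.
Variable R : realType.
Implicit Types (S : set (\bar R)) (u v w c : \bar R).

Lemma sup0_ge0 S : 0 <= sup0 S.
Proof. by rewrite le_max lexx. Qed.

Lemma sup0_ubound S c : S c -> c <= sup0 S.
Proof. by move=> Sc; rewrite le_max ereal_sup_ubound ?orbT. Qed.

Lemma ge_sup0 S c : 0 <= c -> ubound S c -> sup0 S <= c.
Proof. by move=> c0 Sc; rewrite ge_max c0 ge_ereal_sup. Qed.

Lemma ihom_ge0 u v : 0 <= ihom u v.
Proof. by rewrite le_max lexx orbT. Qed.

(** Hom-tensor adjunction of [0, oo]. For [u = +oo] both sides hold, since [v - +oo] is [-oo] even
    at [v = +oo]. *)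
Lemma ihom_le u v w : 0 <= u -> 0 <= w -> (ihom u v <= w) = (v <= u + w).
Proof.
move=> u0 w0; rewrite ge_max w0 andbT.
case: u u0 => [u _|_|//]; first by rewrite leeBlDl.
by rewrite addye ?addeNy ?leey ?leNye // gt_eqF // (lt_le_trans _ w0) // ltNyr.
Qed.
End Sup0.

(** * Left modules of filters and epsilon criteria for flatness *)

Section Modules.
Variables (R : realType) (A : gmetric R).
Implicit Types (F G : set_system A) (M N : lmodule A) (P : index_class R).

Lemma Mminus_ge0 F x : 0 <= Mminus F x.
Proof. exact: sup0_ge0. Qed.

Lemma Mminus_act F x y : Mminus F x <= Mminus F y + dist x y.
Proof.
apply: ge_sup0 => [|_ [f Ff <-]]; first by rewrite adde_ge0 ?Mminus_ge0 ?dist_ge0.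
apply: (@le_trans _ _ (ereal_inf [set dist y z | z in f] + dist x y)).
  (* Only a finite [dist x y] can be moved across the inequality; an infinite one makes the
     right-hand side [+oo], an infimum of distances never being [-oo]. *)
  have [->|yoo] := eqVneq (dist x y) +oo.
    rewrite addey ?leey // gt_eqF // (@lt_le_trans _ _ 0) ?ltNy0 //.
    by apply: le_ereal_inf_tmp => _ [z _ <-]; exact: dist_ge0.
  have fxy : dist x y \is a fin_num by rewrite ge0_fin_numE ?dist_ge0 // ltey.
  rewrite -leeBlDr //; apply: le_ereal_inf_tmp => _ [z fz <-].
  rewrite leeBlDr //; apply: le_trans (dist_triangle x y z).
  by apply: ereal_inf_lbound; exists z.
by apply: leeD2r; apply: sup0_ubound; exists f.
Qed.

Definition Mminus_module F : lmodule A :=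
  LModule (Mminus_ge0 F) (@Mminus_act F).

Lemma le_Mminus F G x : F `<=` G -> Mminus F x <= Mminus G x.
Proof.
move=> FG; apply: ge_sup0 => [|_ [f Ff <-]]; first exact: Mminus_ge0.
by apply: sup0_ubound; exists f => //; exact: FG.
Qed.

Lemma Mminus_witness F f x (c : \bar R) :
  F f -> Mminus F x < c -> exists2 y, f y & dist x y < c.
Proof.
move=> Ff Fxc; have : ereal_inf [set dist x y | y in f] < c.
  by apply: le_lt_trans Fxc; apply: sup0_ubound; exists f.
by case/ereal_inf_lt => _ [y fy <-]; exists y.
Qed.

Lemma weakly_flatP F : weakly_flat F <->
  forall e : R, (0 < e)%R -> exists2 f, F f & forall x, f x -> Mminus F x <= e%:E.
Proof.
split=> [wF e e0|wF].
  have : ereal_inf [set sup0 [set Mminus F x | x in f] | f in F] < e%:E.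
    by rewrite wF lte_fin.
  case/ereal_inf_lt => _ [f Ff <-] /ltW fe; exists f => // x fx.
  by apply: le_trans fe; apply: sup0_ubound; exists x.
apply/le_anti/andP; split; last first.
  by apply: le_ereal_inf_tmp => _ [f _ <-]; exact: sup0_ge0.
apply/lee_addgt0Pr => e e0; rewrite add0e; have [f Ff fe] := wF e e0.
apply: (@le_trans _ _ (sup0 [set Mminus F x | x in f])).
  by apply: ereal_inf_lbound; exists f.
by apply: ge_sup0 => [|_ [x fx <-]]; [rewrite lee_fin ltW | exact: fe].
Qed.

(* Only the inequality <= has to be checked: the other one always holds. *)
Lemma is_flatI P M :
  (forall (K : gmetric R) (H : rmodule K), P K H ->
    forall (L : K -> rmodule A) (s : R), (0 <= s)%R ->
    (forall k, ereal_inf (range (fun x : A => M x + L k x)) <= H k + s%:E) ->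
    forall e : R, (0 < e)%R ->
    exists2 x : A, M x <= e%:E & forall k, L k x <= H k + (s + e)%:E) ->
  is_flat P M.
Proof.
move=> flM K H PH L _; set s := (X in _ = X).
have s0 : 0 <= s by exact: sup0_ge0.
apply/le_anti/andP; split.
  have [->|soo] := eqVneq s +oo; first exact: leey.
  have sE : s = (fine s)%:E by rewrite fineK // ge0_fin_numE // ltey.
  (* One half of [e] bounds [M x], the other the excess of the weighted supremum over [s]. *)
  apply/lee_addgt0Pr => e e0; have e20 : (0 < e / 2)%R by rewrite divr_gt0.
  have [||x Mx Lx] := flM K H PH L (fine s) _ _ (e / 2)%R e20.
  - exact: fine_ge0.
  - move=> k; rewrite -sE -ihom_le ?rmodule_ge0 //.
    by apply: sup0_ubound; exists k.
  apply: le_trans (ereal_inf_lbound _) _; first by exists x.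
  rewrite [e]splitr EFinD addeA addeC; apply: leeD => //.
  rewrite sE -EFinD; apply: ge_sup0 => [|_ [k _ <-]].
    by rewrite lee_fin addr_ge0 ?fine_ge0 // ltW.
  by rewrite ihom_le ?rmodule_ge0 // lee_fin addr_ge0 ?fine_ge0 // ltW.
apply: le_ereal_inf_tmp => _ [x _ <-].
apply: ge_sup0 => [|_ [k _ <-]]; first by rewrite adde_ge0 ?lmodule_ge0 ?sup0_ge0.
rewrite ihom_le ?rmodule_ge0 ?adde_ge0 ?lmodule_ge0 ?sup0_ge0 //.
apply: le_trans (ereal_inf_lbound _) _; first by exists x.
rewrite addeCA leeD2l // -ihom_le ?rmodule_ge0 ?sup0_ge0 //.
by apply: sup0_ubound; exists k.
Qed.

(** Near-minimisers of [Mminus F + L k], one for each [k], are first moved into a common member [g],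
    then all approximated by a single point [y]; [rmodule_act] bounds the cost of each move. The
    last hypothesis provides the second move. *)
Lemma is_flat_Mminus P F : ProperFilter F -> weakly_flat F ->
  (forall (K : gmetric R) (H : rmodule K), P K H -> forall e : R, (0 < e)%R ->
    exists2 f, F f & forall x : K -> A, (forall k, f (x k)) ->
    forall g, F g -> exists2 y, g y & forall k, dist (x k) y <= e%:E) ->
  is_flat P (Mminus_module F).
Proof.
move=> pF /weakly_flatP wF dirF; apply: is_flatI => K H PH L s s0 infs e e0.
(* Three errors add up in [L k y]: near-minimality, the move into [g], and the move to [y]. *)
have d0 : (0 < e / 3)%R by rewrite divr_gt0.
have [f Ff fd] := wF _ d0; have [g Fg gdir] := dirF K H PH _ d0.
have Fgf : F (g `&` f) by exact: filterI.
have /choice[z zP] : forall k, exists z, g z /\ L k z <= H k + (s + e / 3 + e / 3)%:E.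
  (* An infinite weight imposes no constraint, so any point of [g] serves; a finite one leaves room
     for a strict inequality, hence for a near-minimiser. *)
  move=> k; have [Hoo|Hoo] := eqVneq (H k) +oo.
    have [z gz] := filter_ex Fg; exists z; split=> //.
    by rewrite Hoo addye ?leey.
  have HE : H k = (fine (H k))%:E by rewrite fineK // ge0_fin_numE ?rmodule_ge0 // ltey.
  have : ereal_inf (range (fun x : A => Mminus_module F x + L k x)) <
      H k + (s + e / 3)%:E.
    apply: le_lt_trans (infs k) _; rewrite HE -!EFinD lte_fin.
    by rewrite ltrD2l ltrDl.
  case/ereal_inf_lt => _ [x _ <-] /= xlt.
  have Mfin : Mminus F x \is a fin_num.
    rewrite ge0_fin_numE ?Mminus_ge0 // (@le_lt_trans _ _ (Mminus F x + L k x)) //.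
      by rewrite leeDl ?rmodule_ge0.
    by apply: lt_trans xlt _; rewrite HE -EFinD ltry.
  have [|y gy xy] := @Mminus_witness F g x (Mminus F x + (e / 3)%:E) Fg.
    by rewrite lteDl ?lte_fin.
  exists y; split=> //; apply: le_trans (rmodule_act (L k) x y) _.
  apply: (@le_trans _ _ (Mminus F x + (e / 3)%:E + L k x)).
    by apply: leeD2r; exact: ltW.
  by rewrite addeAC [(s + _ + _)%:E]EFinD (addeA (H k)) leeD2r // ltW.
have [y [gy fy] yd] := gdir z (fun k => (zP k).1) _ Fgf.
exists y => [|k].
  by apply: le_trans (fd _ fy) _; rewrite lee_fin ler_pdivrMr // ler_peMr ?ltW // ltr1n.
apply: le_trans (rmodule_act (L k) (z k) y) _.
apply: le_trans (leeD (yd k) (zP k).2) _.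
rewrite addeCA -EFinD leeD2l // lee_fin -!addrA [(e / 3 + (s + _))%R]addrCA lerD2l.
by rewrite -{4}(@divfK _ 3 _ e) ?pnatr_eq0 // !mulrDr !mulr1 addrA.
Qed.

(** The bounds by [H k] make every hom on the right of the flatness equation vanish, so the infimum
    on the left is 0; a point where its term is at most [e] satisfies both conclusions. *)
Lemma flat_witness P M (K : gmetric R) (H : rmodule K) (L : K -> rmodule A) :
  is_flat P M -> P K H -> (forall k l x, L l x <= dist k l + L k x) ->
  (forall k, ereal_inf (range (fun x : A => M x + L k x)) <= H k) ->
  forall e : R, (0 < e)%R ->
  exists2 x : A, M x <= e%:E & forall k, L k x <= H k + e%:E.
Proof.
move=> flM PH Lact infH e e0; have ge0e : 0 <= e%:E by rewrite lee_fin ltW.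
have : ereal_inf (range (fun x : A =>
    M x + sup0 (range (fun k : K => ihom (H k) (L k x))))) < e%:E.
  rewrite (flM K H PH L Lact) (@le_lt_trans _ _ 0) ?lte_fin //.
  by apply: ge_sup0 => // _ [k _ <-]; rewrite ihom_le ?adde0 ?rmodule_ge0.
case/ereal_inf_lt => _ [x _ <-] /ltW xe; exists x => [|k].
  by apply: le_trans xe; rewrite leeDl ?sup0_ge0.
rewrite -ihom_le ?rmodule_ge0 //; apply: le_trans xe.
apply: (@le_trans _ _ (sup0 (range (fun k : K => ihom (H k) (L k x))))).
  by apply: sup0_ubound; exists k.
by rewrite leeDr ?lmodule_ge0.
Qed.
End Modules.

(** * Discrete index spaces *)

Section Discrete.
Variables (R : realType) (I : finType).

(** Infinite distance makes the action inequalities trivial between distinct points, so any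
    nonnegative family is a weight and any family of right modules a diagram. *)
Definition discrete_dist (i j : I) : \bar R := if i == j then 0 else +oo.

Lemma discrete_dist_ge0 i j : 0 <= discrete_dist i j.
Proof. by rewrite /discrete_dist; case: ifP. Qed.

Lemma discrete_distxx i : discrete_dist i i = 0.
Proof. by rewrite /discrete_dist eqxx. Qed.

Lemma discrete_dist_triangle i j k :
  discrete_dist i k <= discrete_dist j k + discrete_dist i j.
Proof.
rewrite /discrete_dist; case: (eqVneq i j) => [->|_]; first by rewrite adde0.
by rewrite addey ?leey //; case: ifP.
Qed.

Definition discrete : gmetric R :=
  GMetric discrete_dist_ge0 discrete_distxx discrete_dist_triangle.

Lemma discrete_act (T : I -> \bar R) : (forall i, 0 <= T i) ->
  forall i j, T j <= discrete_dist i j + T i.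
Proof.
move=> T0 i j; rewrite /discrete_dist.
case: (eqVneq i j) => [->|_]; first by rewrite add0e.
by rewrite addye ?leey // gt_eqF // (lt_le_trans _ (T0 i)) // ltNy0.
Qed.

Definition discrete_rmodule (T : I -> \bar R) (T0 : forall i, 0 <= T i) :
  rmodule discrete := @RModule R discrete T T0 (discrete_act T0).
End Discrete.

(** * Flat filters, filters of flat modules, and the reflections *)

Section FlatFilters.
Variables (R : realType) (A : gmetric R).
Implicit Types (F : set_system A) (M : lmodule A) (P : index_class R).

Definition representable (x : A) : rmodule A :=
  @RModule R A (dist x) (dist_ge0 x) (fun y z => dist_triangle x y z).

Definition admits_discrete P (I : finType) : Prop :=
  forall H : rmodule (discrete R I), P (discrete R I) H.

(* Flatness applied to the representables at the [x i], weighted by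
   [M (x i)] = inf_y (M y + dist (x i) y). *)
Lemma flat_discrete_witness P M (I : finType) (x : I -> A) :
  is_flat P M -> admits_discrete P I -> forall e : R, (0 < e)%R ->
  exists2 y, M y <= e%:E & forall i, dist (x i) y <= M (x i) + e%:E.
Proof.
move=> flM PI.
apply: (@flat_witness R A P M (discrete R I)
  (discrete_rmodule (fun i => lmodule_ge0 M (x i)))
  (fun i => representable (x i)) flM (PI _)).
  move=> i j y; exact: (discrete_act (fun i => dist_ge0 (x i) y)).
move=> i; apply: ereal_inf_lbound; exists (x i) => //=.
by rewrite distxx adde0.
Qed.

Lemma P1_void : admits_discrete (@P1 R) void.
Proof. by move=> H; left; case. Qed.

Lemma P1_unit : admits_discrete (@P1 R) unit.
Proof. by move=> H; right; exists tt; case. Qed.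

Lemma P2_finType (I : finType) : admits_discrete (@P2 R) I.
Proof. by move=> H; exact: finite_finset. Qed.

(** The empty and one-point spaces are finite, so a [P2]-flat module has more limits to preserve. *)
Lemma P1_sub_P2 M : is_flat (@P2 R) M -> is_flat (@P1 R) M.
Proof.
move=> flM K H P1H; apply: flM; case: P1H => [K0|[k kP]].
  by rewrite /P2 (_ : setT = set0) // -subset0 => k _; exact: K0 k.
by rewrite /P2 (_ : setT = [set k]) //; apply/seteqP; split=> // l _; exact: kP.
Qed.

Lemma GammaS M (d e : \bar R) : d <= e -> Gamma M d `<=` Gamma M e.
Proof. by move=> de x /le_trans; apply. Qed.

Lemma filter_of_module_Gamma M (e : R) : (0 < e)%R ->
  filter_of_module M (Gamma M e%:E).
Proof. by move=> e0; exists e%:E => //=; rewrite lte_fin. Qed.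

Lemma filter_of_moduleP M g : filter_of_module M g ->
  exists2 e : R, (0 < e)%R & Gamma M e%:E `<=` g.
Proof.
case=> [[e|//|//]] /= e0 eg; first by exists e.
(* [Gamma M] grows with the radius, so 1 can stand in for an infinite one. *)
by exists 1%R => //; apply: subset_trans eg; apply: GammaS; exact: leey.
Qed.

Lemma filter_of_module_proper M :
  is_flat (@P1 R) M -> ProperFilter (filter_of_module M).
Proof.
move=> flM; apply: filter_from_proper.
  apply: filter_from_filter; first by exists 1; rewrite /= lte01.
  move=> d e d0 e0; exists (mine d e); first by rewrite /= lt_min d0.
  by move=> x; rewrite /Gamma/= le_min => /andP.
have ne (e : R) : (0 < e)%R -> Gamma M e%:E !=set0.
  (* The empty family leaves only the bound [M y <= e]. *)
  move=> e0; have [y My _] := @flat_discrete_witness _ M _ (of_void A) flM P1_void e e0.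
  by exists y.
move=> [e|_|//]; first exact: ne.
by have [y] := ne 1%R ltr01; exists y; rewrite /Gamma /= leey.
Qed.

Lemma Mminus_filter_of_module M x :
  is_flat (@P1 R) M -> Mminus (filter_of_module M) x = M x.
Proof.
move=> flM; apply/le_anti/andP; split.
  apply: ge_sup0 => [|_ [g /filter_of_moduleP[d d0 dg] <-]]; first exact: lmodule_ge0.
  apply/lee_addgt0Pr => e e0.
  (* The bound [d] puts the witness in [g], and [e] controls its excess distance; the minimum does
     both. *)
  have m0 : (0 < Num.min d e)%R by rewrite lt_min d0.
  have [y My xy] :=
    @flat_discrete_witness _ M _ (fun _ : unit => x) flM P1_unit _ m0.
  apply: le_trans (ereal_inf_lbound _) _.
    by exists y; [apply: dg; apply: le_trans My _; rewrite lee_fin ge_min lexx|].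
  by apply: le_trans (xy tt) _; rewrite leeD2l // lee_fin ge_min lexx orbT.
(* Conversely, a point [y] of [Gamma M e] has [M x <= M y + dist x y <= e + dist x y]. *)
apply/lee_addgt0Pr => e e0.
apply: (@le_trans _ _ (ereal_inf [set dist x y | y in Gamma M e%:E] + e%:E)).
  rewrite -leeBlDr //; apply: le_ereal_inf_tmp => _ [y Gy <-].
  rewrite leeBlDr //; apply: le_trans (lmodule_act M x y) _.
  by rewrite addeC leeD2l.
apply: leeD2r; apply: sup0_ubound; exists (Gamma M e%:E) => //.
exact: filter_of_module_Gamma.
Qed.

Lemma weakly_flat_filter_of_module M :
  is_flat (@P1 R) M -> weakly_flat (filter_of_module M).
Proof.
move=> flM; apply/weakly_flatP => e e0; exists (Gamma M e%:E) => [|x].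
  exact: filter_of_module_Gamma.
by rewrite Mminus_filter_of_module.
Qed.

Lemma flat_filter_of_module M :
  is_flat (@P2 R) M -> flat_filter (filter_of_module M).
Proof.
move=> flM e e0; have e20 : (0 < e / 2)%R by rewrite divr_gt0.
(* Half of [e] pays for [M (x i)], the other half for the excess distance of the witness. *)
exists (Gamma M (e / 2)%:E) => [|I x Gx g /filter_of_moduleP[d d0 dg]].
  exact: filter_of_module_Gamma.
have m0 : (0 < Num.min d (e / 2))%R by rewrite lt_min d0.
have [y My xy] := flat_discrete_witness x flM (@P2_finType I) m0.
exists y => [|i]; first by apply: dg; apply: le_trans My _; rewrite lee_fin ge_min lexx.
apply: le_trans (xy i) _; rewrite [e in leRHS]splitr EFinD leeD //; first exact: Gx.
by rewrite lee_fin ge_min lexx orbT.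
Qed.

Lemma flat_weakly_flat F : flat_filter F -> weakly_flat F.
Proof.
move=> flF; apply/weakly_flatP => e e0; have [f Ff fP] := flF e e0.
exists f => // x fx; apply: ge_sup0 => [|_ [g Fg <-]]; first by rewrite lee_fin ltW.
have [y gy xy] := fP unit (fun=> x) (fun=> fx) g Fg.
by apply: le_trans (xy tt); apply: ereal_inf_lbound; exists y.
Qed.

Lemma is_flat1_Mminus F :
  ProperFilter F -> weakly_flat F -> is_flat (@P1 R) (Mminus_module F).
Proof.
move=> pF wF; apply: is_flat_Mminus => // K H [K0|[k kP]] e e0.
  exists setT => [|x _ g Fg]; first exact: filterT.
  by have [y gy] := filter_ex Fg; exists y => // k; case: (K0 k).
(* Halving [e] yields the strict bound that [Mminus_witness] requires. *)
have e20 : (0 < e / 2)%R by rewrite divr_gt0.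
have /weakly_flatP/(_ _ e20)[f Ff fe] := wF; exists f => // x fx g Fg.
have [|y gy xy] := @Mminus_witness _ _ F g (x k) e%:E Fg.
  apply: le_lt_trans (fe _ (fx k)) _.
  by rewrite lte_fin ltr_pdivrMr // ltr_pMr // ltr1n.
by exists y => // l; rewrite (kP l) ltW.
Qed.

Lemma is_flat2_Mminus F :
  ProperFilter F -> flat_filter F -> is_flat (@P2 R) (Mminus_module F).
Proof.
move=> pF flF; apply: is_flat_Mminus => [|K H P2K e e0]; first exact: flat_weakly_flat.
(* Viewed as [{classic K}], the bare type [K] is listed by a sequence [s], and [seq_sub s] is a
   [finType] to which [flF] applies. *)
have [s sP] : exists s : seq {classic K}, [set: {classic K}] = [set` s].
  exact/finite_seqP.
have [f Ff fP] := flF e e0; exists f => // x fx g Fg.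
have [y gy xy] := fP _ (fun i : seq_sub s => x (ssval i)) (fun i => fx (ssval i)) g Fg.
exists y => // k; have ks : (k : {classic K}) \in s.
  by have : [set: {classic K}] k by []; rewrite sP.
exact: xy (SeqSub ks).
Qed.

(** Handles both reflections at once: the first two hypotheses give access to the [P1] and weakly
    flat results, the last two make the maps land in the intended posets. *)
Lemma reflector_Mminus P (Q : set_system A -> Prop) :
  (forall M, is_flat P M -> is_flat (@P1 R) M) ->
  (forall F, Q F -> weakly_flat F) ->
  (forall F, ProperFilter F -> Q F -> is_flat P (Mminus_module F)) ->
  (forall M, is_flat P M -> Q (filter_of_module M)) ->
  exists (L : Filters Q -> Flat P A) (G : Flat P A -> Filters Q),
    [/\ forall (F : Filters Q) (x : A), L F x = Mminus F x,
        forall M : Flat P A, G M = filter_of_module M :> set_system A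
      & reflector L G].
Proof.
move=> flP1 Qw flL QG.
pose L (F : Filters Q) : Flat P A :=
  MkFlat (flL F (@filter_sets_proper _ _ _ F) (@filter_setsP _ _ _ F)).
pose G (M : Flat P A) : Filters Q :=
  MkFilters (filter_of_module_proper (flP1 M (@flat_moduleP _ _ _ M)))
            (QG M (@flat_moduleP _ _ _ M)).
have MG (M : Flat P A) x : Mminus (filter_of_module M) x = M x.
  exact: Mminus_filter_of_module (flP1 M (@flat_moduleP _ _ _ M)).
(* [Mminus] is monotone and recovers each flat module from its filter. *)
have fullG : full G.
  by move=> M N /asboolP NM; apply/asboolP => x; rewrite -!MG; exact: le_Mminus.
exists L, G; split=> //; split=> //.
- by move=> F F' /asboolP FF'; apply/asboolP => x; exact: le_Mminus.
- move=> M N /asboolP NM; apply/asboolP => g [e e0 eg]; exists e => //.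
  by apply: subset_trans eg => x; apply: le_trans; exact: NM.
(* Weak flatness gives a member of [F] on which [Mminus F], hence [M], is at most [e]; it lies in
   [Gamma M e] and so in [g]. Conversely, [Mminus] is applied to the inclusion of filters. *)
- move=> F M; apply/asboolP/asboolP => /= [MF g /filter_of_moduleP[e e0 eg]|MF x].
    have /weakly_flatP/(_ e e0)[f Ff fe] := Qw F (@filter_setsP _ _ _ F).
    have pF := @filter_sets_proper _ _ _ F.
    apply: filterS Ff => x fx; apply: eg; exact: le_trans (MF x) (fe x fx).
  by rewrite -MG; exact: le_Mminus.
- by move=> M N MN; apply/le_anti/andP; split; apply: fullG; rewrite MN.
Qed.
End FlatFilters.

Theorem theorem3p15 (R : realType) (A : gmetric R) :
  (exists (L : WFil A -> Flat (@P1 R) A) (G : Flat (@P1 R) A -> WFil A),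
    [/\ forall (F : WFil A) (x : A), L F x = Mminus F x,
        forall M : Flat (@P1 R) A, G M = filter_of_module M :> set_system A
      & reflector L G]) /\
  (exists (L : FFil A -> Flat (@P2 R) A) (G : Flat (@P2 R) A -> FFil A),
    [/\ forall (F : FFil A) (x : A), L F x = Mminus F x,
        forall M : Flat (@P2 R) A, G M = filter_of_module M :> set_system A
      & reflector L G]).
Proof.
split.
  apply: reflector_Mminus => //.
  - exact: is_flat1_Mminus.
  - exact: weakly_flat_filter_of_module.
apply: reflector_Mminus.
- exact: P1_sub_P2.
- exact: flat_weakly_flat.
- exact: is_flat2_Mminus.
- exact: flat_filter_of_module.
Qed.
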